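(* Let $n\ge 3$, let $(C_n,\boldsymbol\sigma)$ be a signed cycle graph with edge signs $\sigma_k=\boldsymbol\sigma(e_k)\in\{+1,-1\}$, $k=1,\ldots,n$, let $\sigma=\sigma_1\sigma_2\cdots\sigma_n$ and let $s\in\{0,1\}$ be such that $\sigma=(-1)^s$. Let $\mu$ be the largest eigenvalue of the adjacency matrix $A(C_n,\boldsymbol\sigma)$, and let $x^\beta_0,y^\beta_0\in\mathbb R^n$ be the cosine and sine vectors corresponding to $\mu$, with components $$x^\beta_{0k}=\sigma_1\cdots\sigma_k\cos\frac{sk\pi}{n},\qquad y^\beta_{0k}=\sigma_1\cdots\sigma_k\sin\frac{sk\pi}{n},\qquad k=1,\ldots,n.$$ (I) The largest eigenvalue $\mu$ determines $\sigma$: $\sigma=+1$ if $\mu=2$, and $\sigma=-1$ if $\mu<2$. (II) Suppose $x^\beta_0$ is known (so $n$ is known, but $\mu$ may not be known). The first coordinate $x^\beta_{01}$ determines $\sigma=(-1)^s$ and therefore $s$. If $s=0$ or $n$ is odd, then $x^\beta_0$ determines the signs $\sigma_k$, $k=1,\ldots,n$, of all edges. If $s=1$ and $n$ is even, $n=2m$, then $x^\beta_0$ determines the signs $\sigma_k$ of all edges other than those with $k=m$ and $k=m+1$. (III) Suppose $y^\beta_0$ is known (so $n$ is known, but $\mu$ may not be known). If $s=1$, then $y^\beta_0$ determines the signs $\sigma_k$ of all edges other than those with $k=1$ and $k=n$. (IV) If both $x^\beta_0$ and $y^\beta_0$ are known, then all edge signs $\sigma_1,\ldots,\sigma_n$ are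 determined.
   Context: A signed cycle $(C_n,\boldsymbol\sigma)$ is the simple cycle $C_n$ of length $n\ge3$ with vertices $v_1,\ldots,v_n$ and edges $e_1,\ldots,e_n$ in cyclic order, $e_k=v_{k-1}v_k$ (with $v_0=v_n$), together with a function $\boldsymbol\sigma:\{e_1,\ldots,e_n\}\to\{+1,-1\}$. Its adjacency matrix $A(C_n,\boldsymbol\sigma)$ is the symmetric $n\times n$ matrix whose $(v_{k-1},v_k)$ and $(v_k,v_{k-1})$ entries equal $\boldsymbol\sigma(e_k)$ and whose other entries are $0$. The number $\sigma=\boldsymbol\sigma(C_n)=\prod_k\boldsymbol\sigma(e_k)$ is the sign of the cycle. The superscript $\beta=(\beta_1,\ldots,\beta_n)\in\{0,1\}^n$ is defined by $\sigma_k=(-1)^{\beta_k}$. The vector $x^\beta_0$ is an eigenvector of $A(C_n,\boldsymbol\sigma)$ for $\mu$; $y^\beta_0$ is an eigenvector for $\mu$ when $s=1$ and is the zero vector when $s=0$. ''The data $D$ determine the quantity $Q$'' means: whenever two signings of $C_n$ (same $n$, same edge labelling, both satisfying the hypotheses of the assertion in question) have the same data $D$, they have the same value of $Q$. *)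

(* Defs.v *)
From HB Require Import structures.
From mathcomp Require Import all_boot all_order all_algebra.
From mathcomp Require Import reals trigo.

Set Implicit Arguments.
Unset Strict Implicit.
Unset Printing Implicit Defensive.
Import Order.TTheory GRing.Theory Num.Theory.

Local Open Scope ring_scope.

(* Indices are shifted by one: k : 'I_n stands for the vertex v_{k+1} and for
   the edge e_{k+1}.  As e_k = v_{k-1} v_k with v_0 = v_n, the edge k joins the
   vertices ord_pred k (cyclic predecessor) and k. *)
Record signing (R : realType) (n : nat) := Signing {
  edge_sign :> 'I_n -> R;
  edge_signP : forall k, edge_sign k = 1 \/ edge_sign k = - 1
}.

Section SignedCycle.
Variables (R : realType) (n : nat).
Implicit Type sg : signing R n.

(* The two tests exclude each other when n >= 3. *)
Definition adjacency sg : 'M[R]_n :=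
  \matrix_(i, j) if i == ord_pred j then sg j
                 else if j == ord_pred i then sg i else 0.

Definition largest_eigenvalue (A : 'M[R]_n) (mu : R) : Prop :=
  eigenvalue A mu /\ forall a, eigenvalue A a -> a <= mu.

Definition cycle_sign sg : R := \prod_(k < n) sg k.

Definition sign_exponent sg : nat := if cycle_sign sg == 1 then 0 else 1.

Lemma cycle_signE sg : cycle_sign sg = (-1) ^+ sign_exponent sg.
Proof.
have : cycle_sign sg = 1 \/ cycle_sign sg = -1.
  apply: (big_ind (fun x : R => x = 1 \/ x = -1)); first by left.
    by move=> x y [->|->] [->|->]; rewrite ?mulr1 ?mul1r ?mulrNN ?mulr1; auto.
  by move=> k _; apply: edge_signP.
rewrite /sign_exponent; case: eqP => [-> //|ne1 [//|->]].
by rewrite expr1.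
Qed.

Definition prefix_sign sg (k : 'I_n) : R := \prod_(j < n | (j <= k)%N) sg j.

Definition cosine_vector sg : 'cV[R]_n :=
  \col_k (prefix_sign sg k * cos ((sign_exponent sg * k.+1)%:R * pi / n%:R)).

Definition sine_vector sg : 'cV[R]_n :=
  \col_k (prefix_sign sg k * sin ((sign_exponent sg * k.+1)%:R * pi / n%:R)).

(* Among the signings satisfying H, the data determine the quantity. *)
Definition determines (D Q : Type) (H : signing R n -> Prop)
    (data : signing R n -> D) (quantity : signing R n -> Q) : Prop :=
  forall sg sg', H sg -> H sg' -> data sg = data sg' ->
    quantity sg = quantity sg'.

End SignedCycle.

(* Main.v *)
Require Import Defs.
From mathcomp Require Import all_boot all_order all_algebra.
From mathcomp Require Import reals trigo.
From mathcomp Require Import ring lra zify.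

Set Implicit Arguments.
Unset Strict Implicit.
Unset Printing Implicit Defensive.
Import Order.TTheory GRing.Theory Num.Theory.

Local Open Scope ring_scope.

(** Everything rests on the partial products [p_k = sigma_1 ... sigma_k].

    Part (I) comes from reading the signs as parallel transport around the
    cycle.  If [u] is an eigenvector for [a], then
      [sum_k (u_k - sigma_k u_(k-1))^2 = (2 - a) sum_k u_k^2]
    ([sum_sqr_transport_defect]).  Hence no eigenvalue exceeds 2, and an
    eigenvector for 2 satisfies [u_k = sigma_k u_(k-1)] at every edge; going
    once around the cycle multiplies such a [u] by [sigma], so a nonzero one
    exists exactly when [sigma = 1], and then [u = p] is one
    ([eigenvalue2_adjacency]).  So the largest eigenvalue equals 2 if and only
    if [sigma = 1]; the exact value [2 cos(pi/n)] for [sigma = -1] never enters.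

    Parts (II)-(IV) recover the edge signs as quotients of consecutive [p_k]
    ([eq_edge_sign]).  The coordinate [p_1 cos(s pi/n)] has square 1 exactly
    when [s = 0], so it gives [s].  Once [s] is known, the k-th coordinate of
    the cosine (sine) vector gives [p_k] unless the known trigonometric factor
    vanishes.  For [s = 1] the cosine vanishes only at [k = n/2], which leaves
    open the two edges [n/2] and [n/2 + 1] whose signs involve that [p_k], and
    the sine vanishes only at [k = n], which leaves open the edges [1] and [n].
    Since the cosine and the sine never vanish together, both vectors give
    every [p_k], in closed form by [cos^2 + sin^2 = 1] ([prefix_signE]). *)

(** * Partial products of edge signs *)

Section SignedCycle.
Variables (R : realType) (n : nat).
Implicit Types (sg : signing R n.+1) (j k : 'I_n.+1).

Lemma edge_sign_sqr sg k : sg k ^+ 2 = 1.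
Proof. by case: (edge_signP sg k) => ->; rewrite ?sqrrN expr1n. Qed.

Lemma prefix_sign_sqr sg k : prefix_sign sg k ^+ 2 = 1.
Proof. by rewrite -prodrXl big1 // => j _; rewrite edge_sign_sqr. Qed.

Lemma prefix_sign_neq0 sg k : prefix_sign sg k != 0.
Proof. by rewrite -sqrf_eq0 prefix_sign_sqr oner_eq0. Qed.

Lemma prefix_sign0 sg : prefix_sign sg ord0 = sg ord0.
Proof. by rewrite /prefix_sign (big_pred1 ord0) // => j; rewrite leqn0. Qed.

Lemma prefix_signS sg j k :
  k = j.+1 :> nat -> prefix_sign sg k = sg k * prefix_sign sg j.
Proof.
move=> kj; rewrite /prefix_sign (bigD1 k) //=; congr (_ * _).
apply: eq_bigl => i; rewrite -(inj_eq val_inj) /= kj; lia.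
Qed.

Lemma prefix_sign_max sg : prefix_sign sg ord_max = cycle_sign sg.
Proof. by apply: eq_bigl => i; rewrite -ltnS ltn_ord. Qed.

Lemma cycle_sign_pm1 sg : cycle_sign sg = 1 \/ cycle_sign sg = -1.
Proof.
rewrite cycle_signE; case: (sign_exponent sg) => [|m]; first by left.
by rewrite -signr_odd; case: (odd _); [right|left].
Qed.

Lemma ord_pred0 : ord_pred ord0 = ord_max :> 'I_n.+1.
Proof. by apply: val_inj; rewrite /= modn_small. Qed.

Lemma ord_predS j k : k = j.+1 :> nat -> ord_pred k = j.
Proof.
by move=> kj; apply: val_inj; rewrite /= kj addSn /= modnDr modn_small //.
Qed.

(** Induction along the path [v_1, ..., v_n] of the cycle: only the step from
    the last vertex back to the first is left out. *)
Lemma ord_ind_succ (P : 'I_n.+1 -> Prop) :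
  P ord0 -> (forall j k, k = j.+1 :> nat -> P j -> P k) -> forall k, P k.
Proof.
move=> P0 PS [k kn]; elim: k kn => [|k IHk] kn.
  by rewrite (_ : Ordinal kn = ord0) //; apply: val_inj.
exact: (PS (Ordinal (ltnW kn))).
Qed.

(** The recurrence at the first vertex starts from the last one, [v_0 = v_n];
    taking [k] to be the last vertex then gives [u_n = sigma u_n]. *)
Lemma transport_prefix_sign sg (u : 'I_n.+1 -> R) :
    (forall k, u k = sg k * u (ord_pred k)) ->
  forall k, u k = prefix_sign sg k * u ord_max.
Proof.
move=> uE; apply: ord_ind_succ => [|j k kj IHj].
  by rewrite uE ord_pred0 prefix_sign0.
by rewrite uE (ord_predS kj) IHj (prefix_signS _ kj) mulrA.
Qed.

(** The only edge where the partial products can fail to be transported is the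
    first one, where the recurrence asks for [p_1 = sigma_1 p_n], with
    [p_n = sigma]. *)
Lemma prefix_sign_pred sg k :
  cycle_sign sg = 1 -> prefix_sign sg k = sg k * prefix_sign sg (ord_pred k).
Proof.
move=> sg1; elim/ord_ind_succ: k => [|j k kj _].
  by rewrite ord_pred0 prefix_sign_max sg1 mulr1 prefix_sign0.
by rewrite (ord_predS kj) (prefix_signS _ kj).
Qed.

(** The hypothesis on the predecessor is empty for the first edge, whose sign
    is a partial product by itself. *)
Lemma eq_edge_sign sg sg' k :
    prefix_sign sg k = prefix_sign sg' k ->
    (forall j, k = j.+1 :> nat -> prefix_sign sg j = prefix_sign sg' j) ->
  sg k = sg' k.
Proof.
elim/ord_ind_succ: k => [|j k kj _]; first by rewrite !prefix_sign0.
rewrite !(prefix_signS _ kj) => + /(_ j kj) ej; rewrite ej.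
exact/mulIf/prefix_sign_neq0.
Qed.

(** * The eigenvalue 2 *)

(** At least three vertices are required: otherwise both neighbours of a vertex
    coincide, and a single matrix entry cannot hold two edges. *)
Lemma mul_adjacency sg (u : 'rV[R]_n.+1) j : (3 <= n.+1)%N ->
  (u *m adjacency sg) 0 j =
    sg j * u 0 (ord_pred j) + sg (ordS j) * u 0 (ordS j).
Proof.
move=> n3; have SNpred : ordS j != ord_pred j.
  apply/eqP => /(congr1 (@ordS _)); rewrite ord_predK => /(congr1 val) /=.
  have := ltn_ord j; rewrite -[(_ %% _).+1]addn1 modnDml addn1 => jn e.
  have [jn1|jn1] := ltnP j.+2 n.+1; first by rewrite modn_small in e; lia.
  rewrite -(subnK jn1) modnDr modn_small in e; lia.
(* The terms of the two neighbours; all other entries of column [j] vanish. *)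
rewrite mxE (bigD1 (ord_pred j)) //= (bigD1 (ordS j)) //= big1 ?addr0.
  rewrite !mxE eqxx (negPf SNpred) ordSK eqxx.
  by congr (_ + _); rewrite mulrC.
move=> i /andP[iP iS]; rewrite mxE (negPf iP) ifN ?mulr0 //.
by apply: contraNneq iS => ->; rewrite ord_predK.
Qed.

(** Expand the squares: the signs square to 1, so the square terms give twice
    the squared norm of [u], while the cross terms are minus the quadratic form
    [u A u^T], which for an eigenvector is [a] times the squared norm. *)
Lemma sum_sqr_transport_defect sg (u : 'rV[R]_n.+1) a : (3 <= n.+1)%N ->
    u *m adjacency sg = a *: u ->
  \sum_k (u 0 k - sg k * u 0 (ord_pred k)) ^+ 2
    = (2 - a) * \sum_k u 0 k ^+ 2.
Proof.
move=> n3 uA.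
pose T := \sum_k sg k * u 0 k * u 0 (ord_pred k).
have sumpred : \sum_k u 0 (ord_pred k) ^+ 2 = \sum_k u 0 k ^+ 2.
  by rewrite [RHS](reindex_inj (@ord_pred_inj n.+1)).
(* Each edge is met twice in the quadratic form, once from either end. *)
have aT : a * \sum_k u 0 k ^+ 2 = T + T.
  rewrite {2}/T [X in _ = _ + X](reindex_inj (can_inj (@ordSK n.+1))) /=.
  rewrite -big_split mulr_sumr; apply: eq_bigr => k _ /=.
  have /(congr1 (fun v : 'rV_n.+1 => v 0 k)) := uA.
  by rewrite mul_adjacency // mxE ordSK expr2 mulrA => <-; ring.
rewrite mulrBl aT mulr_natl mulr2n -{2}sumpred opprD addrACA -!sumrB -big_split.
apply: eq_bigr => k _ /=; have := edge_sign_sqr sg k; rewrite !expr2 => s2.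
rewrite mulrBl !mulrBr.
rewrite [_ * u 0 (ord_pred k) * (_ * _)]mulrACA s2; ring.
Qed.

Lemma eigenvalue_adjacency_le2 sg a : (3 <= n.+1)%N ->
  eigenvalue (adjacency sg) a -> a <= 2.
Proof.
move=> n3 /eigenvalueP[u uA u0].
have S_gt0 : 0 < \sum_k u 0 k ^+ 2.
  rewrite lt_def sumr_ge0 ?andbT => [|k _]; last exact: sqr_ge0.
  apply: contra u0 => /eqP/psumr_eq0P S0; apply/eqP/rowP => k; rewrite mxE.
  by apply/eqP; rewrite -sqrf_eq0 S0 // => i _; apply: sqr_ge0.
rewrite -subr_ge0 -(pmulr_lge0 _ S_gt0) -(sum_sqr_transport_defect n3 uA).
by apply: sumr_ge0 => k _; apply: sqr_ge0.
Qed.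

(** At [a = 2] the sum of squares vanishes, so the eigenvectors for 2 are the
    vectors invariant under transport along every edge. *)
Lemma eigenvalue2_adjacency sg : (3 <= n.+1)%N ->
  eigenvalue (adjacency sg) 2 <-> cycle_sign sg = 1.
Proof.
move=> n3; split=> [/eigenvalueP[u uA u0]|sg1].
  have /transport_prefix_sign uE k : u 0 k = sg k * u 0 (ord_pred k).
    apply/eqP; rewrite -subr_eq0 -sqrf_eq0; apply/eqP.
    move: k isT; apply: psumr_eq0P => [k _|]; first exact: sqr_ge0.
    by rewrite (sum_sqr_transport_defect n3 uA) subrr mul0r.
  have um0 : u 0 ord_max != 0.
    apply: contra u0 => /eqP um0; apply/eqP/rowP => k.
    by rewrite uE um0 mulr0 mxE.
  by have := uE ord_max; rewrite prefix_sign_max -[LHS]mul1r => /(mulIf um0).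
apply/eigenvalueP; exists (\row_k prefix_sign sg k).
  apply/rowP => j; rewrite mul_adjacency // !mxE -prefix_sign_pred //.
  rewrite (prefix_sign_pred (ordS j)) // ordSK mulrA -expr2 edge_sign_sqr.
  by rewrite mul1r mulr_natl.
apply/eqP => /rowP/(_ ord0); rewrite !mxE => /eqP.
exact/negP/prefix_sign_neq0.
Qed.

Lemma largest_eigenvalue_sign sg mu : (3 <= n.+1)%N ->
  largest_eigenvalue (adjacency sg) mu -> mu = 2 <-> cycle_sign sg = 1.
Proof.
move=> n3 [mu_eig mu_max]; rewrite -eigenvalue2_adjacency //.
split=> [<- //|/mu_max mu_ge2]; apply/le_anti/andP.
by split=> //; apply: (eigenvalue_adjacency_le2 n3 mu_eig).
Qed.

(** * Cosine and sine coordinates *)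

Lemma sign_exponent01 sg : sign_exponent sg = 0%N \/ sign_exponent sg = 1%N.
Proof. by rewrite /sign_exponent; case: eqP; auto. Qed.

Lemma sin_angle_gt0 k : (k < n)%N -> 0 < sin (k.+1%:R * pi / n.+1%:R) :> R.
Proof.
move=> kn; have pi0 := pi_gt0 R; have n0 : 0 < n.+1%:R :> R by rewrite ltr0n.
apply: sin_gt0_pi; rewrite !(mulr_gt0, invr_gt0, ltr0n) //=.
by rewrite ltr_pdivrMr // mulrC ltr_pM2l // ltr_nat.
Qed.

(** The angle lies in [[0, pi]], where the cosine is injective, so it must be
    [pi / 2]. *)
Lemma cos_angle_eq0 k :
  cos (k.+1%:R * pi / n.+1%:R) = 0 :> R -> n.+1 = (2 * k.+1)%N.
Proof.
move=> c0; have pi0 := pi_gt0 R.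
have n0 : 0 < n.+1%:R :> R by rewrite ltr0n.
have : k.+1%:R * pi / n.+1%:R = pi / 2 :> R.
  apply: cos_inj; last by rewrite c0 cos_pihalf.
    rewrite in_itv /= divr_ge0 ?mulr_ge0 ?(ltW pi0) //=.
    by rewrite ler_pdivrMr // mulrC ler_pM2l // ler_nat.
  by rewrite in_itv /=; lra.
move=> e; apply/eqP; rewrite -(eqr_nat R) natrM; apply/eqP.
apply: (mulIf (lt0r_neq0 pi0)).
have : k.+1%:R * pi / n.+1%:R * n.+1%:R * 2 = pi / 2 * n.+1%:R * 2 :> R.
  by rewrite e.
by rewrite divfK ?gt_eqF // => e2; lra.
Qed.

(** Squaring removes the unknown sign of the first edge and leaves
    [cos(s pi/n)^2], which for [s = 1] is less than 1 because
    [sin(pi/n) > 0]. *)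
Lemma cosine_coord0 sg : (3 <= n.+1)%N ->
  sign_exponent sg = 0%N <-> cosine_vector sg ord0 0 ^+ 2 = 1.
Proof.
move=> n3; rewrite mxE exprMn prefix_sign_sqr mul1r.
case: (sign_exponent01 sg) => ->; split=> //.
  by rewrite mul0n !mul0r cos0 expr1n.
rewrite mul1n => c1; exfalso.
have : 0 < sin ((@ord0 n).+1%:R * pi / n.+1%:R) :> R.
  exact/sin_angle_gt0/ltnW.
move=> /(exprn_gt0 2%N).
by have := cos2Dsin2 ((@ord0 n).+1%:R * pi / n.+1%:R : R); lra.
Qed.

Lemma eq_sign_exponent sg sg' : (3 <= n.+1)%N ->
    cosine_vector sg ord0 0 = cosine_vector sg' ord0 0 ->
  sign_exponent sg = sign_exponent sg'.
Proof.
move=> n3 e; have := cosine_coord0 sg n3; have := cosine_coord0 sg' n3.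
rewrite e; case: (sign_exponent01 sg) => ->;
  by case: (sign_exponent01 sg') => ->; intuition.
Qed.

Lemma eq_prefix_sign_cos sg sg' k :
    sign_exponent sg = sign_exponent sg' ->
    cosine_vector sg = cosine_vector sg' ->
    (sign_exponent sg = 1%N -> n.+1 <> (2 * k.+1)%N) ->
  prefix_sign sg k = prefix_sign sg' k.
Proof.
move=> es /matrixP/(_ k 0); rewrite !mxE -es => e ncrit; apply: mulIf e.
case: (sign_exponent01 sg) ncrit => ->; first by rewrite !mul0r cos0 oner_eq0.
by rewrite mul1n => /(_ erefl) ncrit; apply/eqP => /cos_angle_eq0.
Qed.

Lemma eq_prefix_sign_sin sg sg' k :
    sign_exponent sg = 1%N -> sign_exponent sg' = 1%N ->
    sine_vector sg = sine_vector sg' -> (k < n)%N ->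
  prefix_sign sg k = prefix_sign sg' k.
Proof.
move=> s1 s1' /matrixP/(_ k 0); rewrite !mxE s1 s1' !mul1n => e kn.
by apply: mulIf e; rewrite gt_eqF // sin_angle_gt0.
Qed.

(** The cosine and sine vectors are the coordinates of [p_k] times a unit
    vector; the inner product with that unit vector gives [p_k] back. *)
Lemma prefix_signE sg k (t := (sign_exponent sg * k.+1)%:R * pi / n.+1%:R) :
  prefix_sign sg k = cosine_vector sg k 0 * cos t + sine_vector sg k 0 * sin t.
Proof.
by rewrite !mxE -/t -!mulrA -mulrDr -!expr2 cos2Dsin2 mulr1.
Qed.

End SignedCycle.

Theorem theorem13 (R : realType) (n : nat) (hn : (3 <= n)%N) :
  (* (I) *)
  ((forall (sg sg' : signing R n) (mu : R),
       largest_eigenvalue (adjacency sg) mu ->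
       largest_eigenvalue (adjacency sg') mu ->
       cycle_sign sg = cycle_sign sg') /\
   (forall (sg : signing R n) (mu : R),
       largest_eigenvalue (adjacency sg) mu ->
       (mu = 2 -> cycle_sign sg = 1) /\ (mu < 2 -> cycle_sign sg = - 1))) /\
  (* (II) *)
  ((forall k1 : 'I_n, nat_of_ord k1 = 0%N ->
       determines (fun sg : signing R n => True)
         (fun sg => cosine_vector sg k1 0) (fun sg => cycle_sign sg) /\
       determines (fun sg : signing R n => True)
         (fun sg => cosine_vector sg k1 0) (fun sg => sign_exponent sg)) /\
   (forall k : 'I_n,
       determines (fun sg : signing R n => sign_exponent sg = 0%N \/ odd n)
         (fun sg => cosine_vector sg) (fun sg => sg k)) /\
   (forall m : nat, n = (2 * m)%N ->
     forall k : 'I_n, k.+1 <> m -> k.+1 <> m.+1 ->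
       determines (fun sg : signing R n => sign_exponent sg = 1%N)
         (fun sg => cosine_vector sg) (fun sg => sg k))) /\
  (* (III) *)
  (forall k : 'I_n, k.+1 <> 1%N -> k.+1 <> n ->
       determines (fun sg : signing R n => sign_exponent sg = 1%N)
         (fun sg => sine_vector sg) (fun sg => sg k)) /\
  (* (IV) *)
  (forall k : 'I_n,
       determines (fun sg : signing R n => True)
         (fun sg => (cosine_vector sg, sine_vector sg)) (fun sg => sg k)).
Proof.
case: n hn => // n n3; split; [split|split; [split; [|split]|split]].
- move=> sg sg' mu /(largest_eigenvalue_sign n3) h.
  move=> /(largest_eigenvalue_sign n3); rewrite h.
  case: (cycle_sign_pm1 sg) => ->; case: (cycle_sign_pm1 sg') => ->;
    by intuition.
- move=> sg mu /(largest_eigenvalue_sign n3) h; split=> [/h //|mu_lt2].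
  by case: (cycle_sign_pm1 sg) => // /h mu2; rewrite mu2 ltxx in mu_lt2.
- move=> k1 k10; rewrite (_ : k1 = ord0); last exact: val_inj.
  split=> sg sg' _ _ /(eq_sign_exponent n3) es //.
  by rewrite !cycle_signE es.
- move=> k sg sg' H _ e.
  have es := eq_sign_exponent n3 (congr1 (fun v : 'cV_n.+1 => v ord0 0) e).
  have ep j : prefix_sign sg j = prefix_sign sg' j.
    by apply: eq_prefix_sign_cos e _ => // s1; case: H; [rewrite s1|lia].
  exact: eq_edge_sign.
- move=> m nm k km km1 sg sg' s1 s1' e.
  by apply: eq_edge_sign => [|j kj]; apply: eq_prefix_sign_cos e _;
    rewrite ?s1 //; lia.
- move=> k k1 kn sg sg' s1 s1' e.
  have kn' := ltn_ord k.
  by apply: eq_edge_sign => [|j kj]; apply: eq_prefix_sign_sin e _; lia.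
- move=> k sg sg' _ _ [ex ey].
  have es := eq_sign_exponent n3 (congr1 (fun v : 'cV_n.+1 => v ord0 0) ex).
  by apply: eq_edge_sign => [|j _]; rewrite !prefix_signE ex ey es.
Qed.
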